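(* Consider the uplink problem $$\mathcal{P}1:\quad \min_{\mathbf{f}_{i,u},\,\lambda_{i,u}\ge 0,\ \forall i,u}\ \sum_{i,u}\lambda_{i,u}\quad\text{s.t.}\quad \max_{\mathbf{f}_{i,u}}\Gamma^{\rm ul}_{i,u}\ \ge\ \gamma_{i,u}\quad\forall i,u,$$ and the downlink problem $$\mathcal{P}2:\quad \min_{\mathbf{w}_{i,u},\ \forall i,u}\ \alpha\sum_{i,u}\mathbf{w}_{i,u}^H\mathbf{w}_{i,u}\quad\text{s.t.}\quad \Gamma^{\rm dl}_{i,u}\ \ge\ \gamma_{i,u}\quad\forall i,u,$$ with the quantized SINRs $\Gamma^{\rm ul}_{i,u},\Gamma^{\rm dl}_{i,u}$ defined in the context, and assume that these problems are feasible. Let $\lambda_{i,u}$ be the optimal powers of $\mathcal{P}1$ and let $$\mathbf{f}_{i,u}=\Big[\alpha^2\sum_{(j,v)\neq(i,u)}\lambda_{j,v}\mathbf{h}_{i,j,v}\mathbf{h}_{i,j,v}^H+\alpha\mathbf{I}_{N_b}+\alpha\beta\,\mathrm{diag}(\mathbf{H}_i\boldsymbol{\Lambda}\mathbf{H}_i^H)\Big]^{-1}\mathbf{h}_{i,i,u}$$ be the corresponding uplink MMSE equalizers. Then the optimal downlink precoders (solutions of $\mathcal{P}2$, understood up to multiplication of each $\mathbf{w}_{i,u}$ by a unit-modulus scalar) are linearly proportional to the uplink MMSE equalizers: $$\mathbf{w}_{i,u}=\sqrt{\tau_{i,u}}\,\mathbf{f}_{i,u}\qquad\forall i,u,$$ where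 $\boldsymbol{\tau}=[\boldsymbol{\tau}_1^T,\dots,\boldsymbol{\tau}_{N_c}^T]^T$, $\boldsymbol{\tau}_i=[\tau_{i,1},\dots,\tau_{i,N_u}]^T$, is given by $\boldsymbol{\tau}=\boldsymbol{\Sigma}^{-1}\mathbf{1}_{N_uN_c}$. Here $\mathbf{1}_{N_uN_c}$ is the all-ones vector and $\boldsymbol{\Sigma}=(\boldsymbol{\Sigma}_{i,j})_{i,j=1}^{N_c}$ is the block matrix with blocks $\boldsymbol{\Sigma}_{i,j}\in\mathbb{R}^{N_u\times N_u}$ whose entries are $$[\boldsymbol{\Sigma}_{i,j}]_{u,v}=\begin{cases}\frac{\alpha^2}{\gamma_{i,u}}|\mathbf{f}_{i,u}^H\mathbf{h}_{i,i,u}|^2-\alpha\beta\,\mathbf{f}_{i,u}^H\mathrm{diag}(\mathbf{h}_{i,i,u}\mathbf{h}_{i,i,u}^H)\mathbf{f}_{i,u} & \text{if } i=j\text{ and }u=v,\\[4pt] -\alpha^2|\mathbf{f}_{j,v}^H\mathbf{h}_{j,i,u}|^2-\alpha\beta\,\mathbf{f}_{j,v}^H\mathrm{diag}(\mathbf{h}_{j,i,u}\mathbf{h}_{j,i,u}^H)\mathbf{f}_{j,v} & \text{otherwise.}\end{cases}$$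
   Context: Setting. $N_c,N_u,N_b$ are positive integers (numbers of cells, users per cell, antennas per base station). Indices: $i,j\in\{1,\dots,N_c\}$, $u,v\in\{1,\dots,N_u\}$; $\sum_{i,u}$ is the sum over all such pairs. The channels $\mathbf{h}_{i,j,u}\in\mathbb{C}^{N_b}$ (between base station $i$ and user $u$ of cell $j$) are given, $\mathbf{H}_{i,j}=[\mathbf{h}_{i,j,1},\dots,\mathbf{h}_{i,j,N_u}]$ and $\mathbf{H}_i=[\mathbf{H}_{i,1},\dots,\mathbf{H}_{i,N_c}]\in\mathbb{C}^{N_b\times N_cN_u}$. The quantizer gain is $\alpha\in(0,1]$ and $\beta=1-\alpha$. The target SINRs are $\gamma_{i,u}>0$. For a square matrix $\mathbf{A}$, $\mathrm{diag}(\mathbf{A})$ is the diagonal matrix with the same diagonal entries as $\mathbf{A}$. Uplink. For powers $\lambda_{i,u}\ge0$ let $\boldsymbol{\Lambda}$ be the $N_cN_u\times N_cN_u$ diagonal matrix with entries $\lambda_{1,1},\dots,\lambda_{1,N_u},\dots,\lambda_{N_c,1},\dots,\lambda_{N_c,N_u}$. The quantization noise covariance is $\mathbf{C}_{\mathbf{q}^{\rm ul}_i\mathbf{q}^{\rm ul}_i}=\alpha\beta\,\mathrm{diag}(\mathbf{H}_i\boldsymbol{\Lambda}\mathbf{H}_i^H+\mathbf{I}_{N_b})$. For a combiner $\mathbf{f}_{i,u}\in\mathbb{C}^{N_b}\setminus\{\mathbf{0}\}$, $$\Gamma^{\rm ul}_{i,u}=\frac{\alpha^2\lambda_{i,u}|\mathbf{f}_{i,u}^H\mathbf{h}_{i,i,u}|^2}{\alpha^2\sum_{(j,v)\ne(i,u)}\lambda_{j,v}|\mathbf{f}_{i,u}^H\mathbf{h}_{i,j,v}|^2+\mathbf{f}_{i,u}^H\mathbf{C}_{\mathbf{q}^{\rm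 ul}_i\mathbf{q}^{\rm ul}_i}\mathbf{f}_{i,u}+\alpha^2\|\mathbf{f}_{i,u}\|^2}.$$ Downlink. The precoder of base station $i$ is $\mathbf{W}_i=[\mathbf{w}_{i,1},\dots,\mathbf{w}_{i,N_u}]\in\mathbb{C}^{N_b\times N_u}$, the quantization noise covariance is $\mathbf{C}_{\mathbf{q}^{\rm dl}_i\mathbf{q}^{\rm dl}_i}=\alpha\beta\,\mathrm{diag}(\mathbf{W}_i\mathbf{W}_i^H)$, and $$\Gamma^{\rm dl}_{i,u}=\frac{\alpha^2|\mathbf{w}_{i,u}^H\mathbf{h}_{i,i,u}|^2}{\alpha^2\sum_{(j,v)\ne(i,u)}|\mathbf{w}_{j,v}^H\mathbf{h}_{j,i,u}|^2+\sum_{j=1}^{N_c}\mathbf{h}_{j,i,u}^H\mathbf{C}_{\mathbf{q}^{\rm dl}_j\mathbf{q}^{\rm dl}_j}\mathbf{h}_{j,i,u}+1}.$$ Multiplying each $\mathbf{w}_{i,u}$ by a unit-modulus scalar changes neither the objective nor the constraints of the downlink problem. *)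

(* Defs.v *)
From HB Require Import structures.
From mathcomp Require Import all_boot all_order all_algebra.
From mathcomp Require Import reals.
From mathcomp Require Import complex.
Set Implicit Arguments. Unset Strict Implicit. Unset Printing Implicit Defensive.
Import Order.TTheory GRing.Theory Num.Theory.
Local Open Scope complex_scope.
Local Open Scope sesquilinear_scope.
Local Open Scope ring_scope.

Section HermitianForms.
Variable R : realType.

(* [x^H y]; [M ^t*] is the conjugate transpose. *)
Definition hdot n (x y : 'cV[R[i]]_n) : R[i] := (x^t* *m y) 0 0.

(* [x^H A x]; used only for Hermitian [A] (in fact real diagonal), for which
   this complex number is real, so that [Re] discards nothing. *)
Definition qform n (A : 'M[R[i]]_n) (x : 'cV[R[i]]_n) : R :=
  complex.Re ((x^t* *m A *m x) 0 0).

(* The squared Euclidean norm [x^H x]. *)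
Definition sqnorm n (x : 'cV[R[i]]_n) : R := complex.Re (hdot x x).

(* [|z|^2] as an element of [R] (the generic [`|z|] is an element of [R[i]]). *)
Definition sqmod (z : R[i]) : R := ComplexField.Normc.normc z ^+ 2.

Definition diag_part n (A : 'M[R[i]]_n) : 'M[R[i]]_n :=
  diag_mx (\row_k A k k).

End HermitianForms.

Section System.
Variables (R : realType) (Nc Nu Nb : nat).

(* [h i j u] is the channel between base station [i] and user [u] of cell [j];
   [alpha] is the quantizer gain and [gamma] gives the target SINRs. *)
Variable h : 'I_Nc -> 'I_Nc -> 'I_Nu -> 'cV[R[i]]_Nb.
Variable alpha : R.
Variable gamma : 'I_Nc -> 'I_Nu -> R.

Local Notation beta := (1 - alpha).
Local Notation powers := ('I_Nc -> 'I_Nu -> R).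
Local Notation beams := ('I_Nc -> 'I_Nu -> 'cV[R[i]]_Nb).

(* [Hmx i] is [H_i = [H_{i,1}, ..., H_{i,Nc}]], and the width Nc * Nu is
   represented as [\sum_(j < Nc) Nu], as required by the block operations. *)
Definition Hmx (i : 'I_Nc) : 'M[R[i]]_(Nb, \sum_(j < Nc) Nu) :=
  \mxrow_(j < Nc) \matrix_(k < Nb, u < Nu) h i j u k 0.

Definition Lambda (lam : powers) : 'M[R[i]]_(\sum_(j < Nc) Nu) :=
  \mxdiag_(j < Nc) diag_mx (\row_(u < Nu) (lam j u)%:C).

Definition Cq_ul (lam : powers) (i : 'I_Nc) : 'M[R[i]]_Nb :=
  (alpha * beta)%:C *: diag_part (Hmx i *m Lambda lam *m (Hmx i)^t* + 1%:M).

(* Uplink SINR of user [u] of cell [i] with combiner [x]. *)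
Definition SINR_ul (lam : powers) (i : 'I_Nc) (u : 'I_Nu)
    (x : 'cV[R[i]]_Nb) : R :=
  (alpha ^+ 2 * lam i u * sqmod (hdot x (h i i u)))
  / (alpha ^+ 2 * (\sum_(p : 'I_Nc * 'I_Nu | p != (i, u))
                     lam p.1 p.2 * sqmod (hdot x (h i p.1 p.2)))
     + qform (Cq_ul lam i) x
     + alpha ^+ 2 * sqnorm x).

Definition is_max_SINR_ul (lam : powers) (i : 'I_Nc) (u : 'I_Nu) (m : R) : Prop :=
  (exists2 x, x != 0 & SINR_ul lam i u x = m)
  /\ (forall x, x != 0 -> SINR_ul lam i u x <= m).

(* The combiners [f] are variables of the uplink problem, but they enter neither
   the objective nor the constraint, where the combiner is a bound variable. *)
Definition P1_feasible (f : beams) (lam : powers) : Prop :=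
  [/\ forall i u, f i u != 0,
      forall i u, 0 <= lam i u
    & forall i u, exists2 m, is_max_SINR_ul lam i u m & gamma i u <= m].

Definition P1_objective (lam : powers) : R := \sum_i \sum_u lam i u.

Definition P1_optimal (f : beams) (lam : powers) : Prop :=
  P1_feasible f lam
  /\ forall f' lam', P1_feasible f' lam' -> P1_objective lam <= P1_objective lam'.

Definition Wmx (w : beams) (i : 'I_Nc) : 'M[R[i]]_(Nb, Nu) :=
  \matrix_(k < Nb, u < Nu) w i u k 0.

Definition Cq_dl (w : beams) (i : 'I_Nc) : 'M[R[i]]_Nb :=
  (alpha * beta)%:C *: diag_part (Wmx w i *m (Wmx w i)^t*).

Definition SINR_dl (w : beams) (i : 'I_Nc) (u : 'I_Nu) : R :=
  (alpha ^+ 2 * sqmod (hdot (w i u) (h i i u)))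
  / (alpha ^+ 2 * (\sum_(p : 'I_Nc * 'I_Nu | p != (i, u))
                     sqmod (hdot (w p.1 p.2) (h p.1 i u)))
     + \sum_j qform (Cq_dl w j) (h j i u)
     + 1).

Definition P2_feasible (w : beams) : Prop :=
  forall i u, gamma i u <= SINR_dl w i u.

Definition P2_objective (w : beams) : R :=
  alpha * \sum_i \sum_u sqnorm (w i u).

Definition P2_optimal (w : beams) : Prop :=
  P2_feasible w
  /\ forall w', P2_feasible w' -> P2_objective w <= P2_objective w'.

(* The bracketed matrix is positive definite for [alpha] in ]0, 1] and
   nonnegative [lam], so [invmx] is its genuine inverse there. *)
Definition mmse (lam : powers) : beams := fun i u =>
  invmx ((alpha ^+ 2)%:C *: (\sum_(p : 'I_Nc * 'I_Nu | p != (i, u))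
             (lam p.1 p.2)%:C *: (h i p.1 p.2 *m (h i p.1 p.2)^t*))
         + (alpha%:C)%:M
         + (alpha * beta)%:C *: diag_part (Hmx i *m Lambda lam *m (Hmx i)^t*))
  *m h i i u.

Definition Sigma_block (f : beams) (i j : 'I_Nc) : 'M[R]_Nu :=
  \matrix_(u < Nu, v < Nu)
    if (i == j) && (u == v) then
      alpha ^+ 2 / gamma i u * sqmod (hdot (f i u) (h i i u))
      - alpha * beta * qform (diag_part (h i i u *m (h i i u)^t*)) (f i u)
    else
      - (alpha ^+ 2 * sqmod (hdot (f j v) (h j i u)))
      - alpha * beta * qform (diag_part (h j i u *m (h j i u)^t*)) (f j v).

Definition Sigma (f : beams) : 'M[R]_(\sum_(i < Nc) Nu) :=
  \mxblock_(i < Nc, j < Nc) Sigma_block f i j.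

(* A genuine solution of [Sigma tau = 1] only if [Sigma f] is invertible, as
   [invmx] is the identity on singular matrices. *)
Definition tau_vec (f : beams) : 'cV[R]_(\sum_(i < Nc) Nu) :=
  invmx (Sigma f) *m const_mx 1.

(* [tau_{i,u}], the [u]-th entry of the [i]-th block of [tau]. *)
Definition tau (f : beams) (i : 'I_Nc) (u : 'I_Nu) : R :=
  submxcol (tau_vec f) i u 0.

End System.

(* Main.v *)
(* Write user [p] for a pair (cell, index) and [S w] for the matrix [Sigma] built
   from arbitrary beams [w]. The downlink constraints say [S w 1 >= 1], and for
   combiners [w] the uplink constraints say [lam^T (S w) >= alpha |w|^2]
   entrywise: both problems share the matrix. By Cauchy-Schwarz for the MMSE
   matrix [K_p], the beam [f_p = K_p^-1 h_p] maximizes the uplink SINR of [p],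
   and only its multiples do. At the uplink optimum these maxima equal [gamma_p],
   so [lam^T (S w) <= alpha |w|^2] for all [w], with equality iff each [w_p] is a
   multiple of [f_p]. Pairing with [1] gives
   [sum lam <= lam^T (S w) 1 <= sum alpha |w|^2] for every feasible [w], and
   equality iff [w_p = c_p f_p] and [S f |c|^2 = 1]. The latter system has a
   unique, nonnegative solution: [S f] has nonpositive off-diagonal entries and
   [lam^T (S f) = alpha |f|^2 > 0], so it is a nonsingular M-matrix. *)
Require Import Defs.
From mathcomp Require Import all_boot all_order all_algebra.
From mathcomp Require Import reals.
From mathcomp Require Import complex.
From mathcomp Require Import ring lra.
Set Implicit Arguments. Unset Strict Implicit. Unset Printing Implicit Defensive.
Import Order.TTheory GRing.Theory Num.Theory.
Local Open Scope complex_scope.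
Local Open Scope ring_scope.
Local Open Scope sesquilinear_scope.

(** Weight the rows in the set [S] where [v] is negative by [lam] and add them up. Restricting a
    column of [S] to the rows of [S] drops only nonpositive terms, so its weighted sum stays
    positive and contributes negatively after multiplication by [v]. A column outside [S] meets only
    off-diagonal entries and contributes at most zero. A nonempty [S] thus contradicts [Av_ge0]. *)
Lemma Zmatrix_monotone (F : realFieldType) (T : finType)
    (A : T -> T -> F) (lam v : T -> F)
    (A_offdiag : forall p q, p != q -> A p q <= 0)
    (lam_ge0 : forall p, 0 <= lam p)
    (lamA_gt0 : forall q, 0 < \sum_p lam p * A p q)
    (Av_ge0 : forall p, 0 <= \sum_q A p q * v q) :
  forall p, 0 <= v p.
Proof.
pose S := [pred p | v p < 0].
have colS q : q \in S -> 0 < \sum_(p in S) lam p * A p q.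
  move=> qS; apply: lt_le_trans (lamA_gt0 q) _.
  rewrite (bigID (mem S)) /= gerDl; apply: sumr_le0 => p pS.
  apply: mulr_ge0_le0 => //; apply: A_offdiag.
  by apply: contraNneq pS => ->.
have sum_ge0 : 0 <= \sum_(p in S) lam p * \sum_q A p q * v q.
  by apply: sumr_ge0 => p _; rewrite mulr_ge0.
move=> p; rewrite leNgt; apply/negP => pS; move: sum_ge0.
under eq_bigr do rewrite mulr_sumr.
rewrite exchange_big /=.
under eq_bigr do under eq_bigr do rewrite mulrA.
under eq_bigr do rewrite -mulr_suml.
apply/negP; rewrite -ltNge (bigD1 p) //= -[ltRHS]addr0.
apply: ltr_leD; first by rewrite pmulr_rlt0 // colS.
apply: sumr_le0 => q _; have [qS|qS] := boolP (q \in S).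
  by rewrite nmulr_lle0 // ltW // colS.
rewrite mulr_le0_ge0 //; last by rewrite leNgt.
apply: sumr_le0 => r rS; apply: mulr_ge0_le0 => //; apply: A_offdiag.
by apply: contraNneq qS => <-.
Qed.

(** * Hermitian forms and the remainder in Cauchy-Schwarz *)

Section HermitianForm.
Variables (C : numClosedFieldType) (n : nat) (K : 'M[C]_n).
Hypothesis K_herm : K^t* = K.
Local Notation form x y := ((x^t* *m K *m y) 0 0).

Lemma form_conj (x y : 'cV[C]_n) : form y x = (form x y)^*.
Proof.
have -> : (form x y)^* = ((x^t* *m K *m y)^t*) 0 0 by rewrite !mxE.
by rewrite !trmx_mul !map_mxM trmxCK K_herm mulmxA.
Qed.

(** Cauchy-Schwarz with its exact remainder: [c *: f] is the [K]-orthogonal projection of [x] onto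
    the line of [f], so the defect is the form of the residual. *)
Lemma form_sub_proj (x f : 'cV[C]_n) (xx ff xf : C) (c := xf^* / ff) :
    form x x = xx -> form f f = ff -> form x f = xf -> ff != 0 ->
  form (x - c *: f) (x - c *: f) * ff = xx * ff - `|xf| ^+ 2.
Proof.
move=> xxE ffE xfE ff0.
have fxE : form f x = xf^* by rewrite form_conj xfE.
have ffJ : ff^* = ff by rewrite -ffE -form_conj.
have conjB : (x - c *: f)^t* = x^t* - c^* *: f^t*.
  by apply/matrixP => i j; rewrite !mxE rmorphB rmorphM.
have -> : form (x - c *: f) (x - c *: f) =
    xx - c * xf - c^* * xf^* + c^* * c * ff.
  rewrite conjB !(mulmxBr, mulmxBl) -?(scalemxAl, scalemxAr).
  (* Generalizing the four products keeps [mxE] from expanding them into sums. *)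
  move: (x^t* *m K *m x) (x^t* *m K *m f) (f^t* *m K *m x) (f^t* *m K *m f)
    xxE xfE fxE ffE => ? ? ? ?.
  by rewrite !mxE => -> -> -> ->; ring.
by rewrite /c fmorph_div /= ffJ conjCK normCK; field.
Qed.
End HermitianForm.

(** * Real-valued norms and forms of complex vectors *)

Section ComplexVectors.
Variable R : realType.
Implicit Types z : R[i].

Lemma realC_M (a b : R) : (a * b)%:C = a%:C * b%:C :> R[i].
Proof. exact: rmorphM. Qed.

Lemma realC_sum (I : Type) (r : seq I) (P : pred I) (F : I -> R) :
  (\sum_(k <- r | P k) F k)%:C = \sum_(k <- r | P k) (F k)%:C :> R[i].
Proof. exact: rmorph_sum. Qed.

Lemma sqmodE z : (sqmod z)%:C = `|z| ^+ 2.
Proof. by rewrite /sqmod rmorphXn. Qed.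

Lemma sqmod_ge0 z : 0 <= sqmod z. Proof. exact: sqr_ge0. Qed.

Lemma sqmod_eq0 z : (sqmod z == 0) = (z == 0).
Proof.
rewrite /sqmod expf_eq0 /=; apply/eqP/eqP => [/ComplexField.Normc.eq0_normc //|->].
exact: ComplexField.Normc.normc0.
Qed.

Lemma sqmodM z1 z2 : sqmod (z1 * z2) = sqmod z1 * sqmod z2.
Proof. by rewrite /sqmod ComplexField.Normc.normcM exprMn. Qed.

Lemma sqmod_real (a : R) : sqmod a%:C = a ^+ 2.
Proof. by rewrite /sqmod /= expr0n /= addr0 sqr_sqrtr // sqr_ge0. Qed.

Lemma sqrt_sqmod z : (Num.sqrt (sqmod z))%:C = `|z|.
Proof.
by rewrite /sqmod sqrtr_sqr ger0_norm // -ler0c; exact: normr_ge0 z.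
Qed.

Lemma sqmodJ z : sqmod z^* = sqmod z.
Proof. by apply: complexI; rewrite !sqmodE norm_conjC. Qed.

Lemma conjM_sqmod z : z^* * z = (sqmod z)%:C.
Proof. by rewrite sqmodE normCKC. Qed.

Lemma Re_sum (I : Type) (r : seq I) (P : pred I) (F : I -> R[i]) :
  complex.Re (\sum_(k <- r | P k) F k) = \sum_(k <- r | P k) complex.Re (F k).
Proof.
by elim/big_rec2: _ => // k y x _ <-; case: (F k) x => [a b] [c d].
Qed.

Lemma Re_mulrl (a : R) z : complex.Re (a%:C * z) = a * complex.Re z.
Proof. by case: z => x y /=; rewrite mul0r subr0. Qed.

Lemma hdotE n (x y : 'cV[R[i]]_n) : hdot x y = \sum_k (x k 0)^* * y k 0.
Proof. by rewrite /hdot mxE; apply: eq_bigr => k _; rewrite !mxE. Qed.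

Lemma hdotZl n a (x y : 'cV[R[i]]_n) : hdot (a *: x) y = a^* * hdot x y.
Proof.
by rewrite !hdotE mulr_sumr; apply: eq_bigr => k _; rewrite !mxE rmorphM mulrA.
Qed.

Lemma hdot0r n (y : 'cV[R[i]]_n) : hdot y 0 = 0.
Proof. by rewrite /hdot mulmx0 mxE. Qed.

Lemma sqnormE n (x : 'cV[R[i]]_n) : sqnorm x = \sum_k sqmod (x k 0).
Proof.
by rewrite /sqnorm hdotE Re_sum; apply: eq_bigr => k _; rewrite conjM_sqmod.
Qed.

Lemma hdot_sqnorm n (x : 'cV[R[i]]_n) : hdot x x = (sqnorm x)%:C.
Proof.
by rewrite sqnormE hdotE realC_sum; apply: eq_bigr => k _; exact: conjM_sqmod.
Qed.

Lemma sqnormZ n a (x : 'cV[R[i]]_n) : sqnorm (a *: x) = sqmod a * sqnorm x.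
Proof.
by rewrite !sqnormE mulr_sumr; apply: eq_bigr => k _; rewrite mxE sqmodM.
Qed.

Lemma sqnorm_ge0 n (x : 'cV[R[i]]_n) : 0 <= sqnorm x.
Proof. by rewrite sqnormE sumr_ge0 // => k _; exact: sqmod_ge0. Qed.

Lemma sqnorm_gt0 n (x : 'cV[R[i]]_n) : (0 < sqnorm x) = (x != 0).
Proof.
rewrite lt0r sqnorm_ge0 andbT; congr (~~ _); rewrite sqnormE.
apply/idP/eqP => [|->]; last first.
  by rewrite big1 // => k _; rewrite mxE; apply/eqP; rewrite sqmod_eq0.
rewrite psumr_eq0 => [/allP x0|k _]; last exact: sqmod_ge0.
apply/matrixP => k j; rewrite ord1 mxE; apply/eqP.
by have:= x0 k (mem_index_enum k); rewrite sqmod_eq0.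
Qed.

(** This is [x^H diag(y y^H) x]. Its symmetry in [x] and [y] is what lets uplink and downlink share
    the same quantization terms. *)
Definition noise n (x y : 'cV[R[i]]_n) : R :=
  \sum_k sqmod (x k 0) * sqmod (y k 0).

Lemma noise_ge0 n (x y : 'cV[R[i]]_n) : 0 <= noise x y.
Proof. by apply: sumr_ge0 => k _; rewrite mulr_ge0 // sqmod_ge0. Qed.

Lemma noiseZl n a (x y : 'cV[R[i]]_n) : noise (a *: x) y = sqmod a * noise x y.
Proof.
by rewrite /noise mulr_sumr; apply: eq_bigr => k _; rewrite mxE sqmodM mulrA.
Qed.

Lemma form_diag_part n (A : 'M[R[i]]_n) (d : 'I_n -> R) (x : 'cV[R[i]]_n)
    (AE : forall k, A k k = (d k)%:C) :
  (x^t* *m diag_part A *m x) 0 0 = (\sum_k d k * sqmod (x k 0))%:C.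
Proof.
rewrite /diag_part mul_mx_diag mxE realC_sum; apply: eq_bigr => k _.
by rewrite !mxE AE realC_M -conjM_sqmod; ring.
Qed.

Lemma form_outer n (x y : 'cV[R[i]]_n) :
  (x^t* *m (y *m y^t*) *m x) 0 0 = (sqmod (hdot x y))%:C.
Proof.
rewrite mulmxA -[_ *m x]mulmxA mxE big_ord1 -conjM_sqmod mulrC.
congr (_ * _); rewrite -[LHS]/(hdot y x) !hdotE rmorph_sum.
by apply: eq_bigr => k _ /=; rewrite rmorphM /= conjCK mulrC.
Qed.

Lemma qformZ n (a : R) (A : 'M[R[i]]_n) x : qform (a%:C *: A) x = a * qform A x.
Proof. by rewrite /qform -scalemxAr -scalemxAl mxE Re_mulrl. Qed.

Lemma qform_diag_part n (A : 'M[R[i]]_n) (d : 'I_n -> R) (x : 'cV[R[i]]_n)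
    (AE : forall k, A k k = (d k)%:C) :
  qform (diag_part A) x = \sum_k d k * sqmod (x k 0).
Proof. by rewrite /qform (form_diag_part _ AE). Qed.

Lemma qform_diag_outer n (x y : 'cV[R[i]]_n) :
  qform (diag_part (y *m y^t*)) x = noise x y.
Proof.
rewrite (@qform_diag_part _ _ (fun k => sqmod (y k 0))).
  by apply: eq_bigr => k _; rewrite mulrC.
by move=> k; rewrite mxE big_ord1 !mxE mulrC conjM_sqmod.
Qed.
End ComplexVectors.

(** * SINRs and the matrix [Sigma] as sums over users *)

Section System.
Variables (R : realType) (Nc Nu Nb : nat).
Variable h : 'I_Nc -> 'I_Nc -> 'I_Nu -> 'cV[R[i]]_Nb.
Variable alpha : R.
Variable gamma : 'I_Nc -> 'I_Nu -> R.

Local Notation user := ('I_Nc * 'I_Nu)%type.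
Local Notation beta := (1 - alpha).
Local Notation powers := ('I_Nc -> 'I_Nu -> R).
Local Notation beams := ('I_Nc -> 'I_Nu -> 'cV[R[i]]_Nb).
Implicit Types p q r : user.
Local Notation "w '_[' p ]" := (w p.1 p.2) (at level 8, format "w _[ p ]").

(* The denominator of the uplink SINR; the quantized and the plain thermal noise
   add up to [alpha * beta + alpha ^+ 2 = alpha]. *)
Definition ul_den (lam : powers) (p : user) (x : 'cV[R[i]]_Nb) : R :=
  alpha ^+ 2 * (\sum_(q : user | q != p) lam _[q] * sqmod (hdot x (h p.1)_[q]))
  + alpha * beta * (\sum_(q : user) lam _[q] * noise x (h p.1)_[q])
  + alpha * sqnorm x.

Definition mmse_mx (lam : powers) (p : user) : 'M[R[i]]_Nb :=
  (alpha ^+ 2)%:C *: (\sum_(q : user | q != p)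
     (lam q.1 q.2)%:C *: (h p.1 q.1 q.2 *m (h p.1 q.1 q.2)^t*))
  + (alpha%:C)%:M
  + (alpha * beta)%:C
      *: diag_part (Hmx h p.1 *m Lambda lam *m (Hmx h p.1)^t*).

Lemma mmseE (lam : powers) (p : user) :
  (mmse h alpha lam) _[p] = invmx (mmse_mx lam p) *m (h p.1)_[p].
Proof. by rewrite /mmse /mmse_mx -surjective_pairing. Qed.

Lemma Hmx_Lambda_diag (lam : powers) i k :
  (Hmx h i *m Lambda lam *m (Hmx h i)^t*) k k
    = (\sum_(q : user) lam _[q] * sqmod ((h i)_[q] k 0))%:C.
Proof.
have -> : (Hmx h i)^t*
    = \mxcol_j (\matrix_(k < Nb, u < Nu) h i j u k 0)^t*.
  by apply/matrixP => a b; rewrite !mxE.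
rewrite /Hmx /Lambda mul_mxrow_mxdiag mul_mxrow_mxcol summxE realC_sum.
rewrite -(pair_bigA _ (fun j u => (lam j u * sqmod (h i j u k 0))%:C)) /=.
apply: eq_bigr => j _; rewrite mul_mx_diag mxE; apply: eq_bigr => u _.
by rewrite !mxE realC_M -conjM_sqmod; ring.
Qed.

Lemma Hmx_noise (lam : powers) i (x : 'cV[R[i]]_Nb) :
  \sum_k (\sum_(q : user) lam _[q] * sqmod ((h i)_[q] k 0)) * sqmod (x k 0)
    = \sum_(q : user) lam _[q] * noise x (h i)_[q].
Proof.
under eq_bigr do rewrite mulr_suml.
rewrite exchange_big; apply: eq_bigr => q _; rewrite /noise mulr_sumr.
by apply: eq_bigr => k _; ring.
Qed.

(** This identity makes maximizing the uplink SINR a Cauchy-Schwarz problem for the MMSE matrix. *)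
Lemma form_mmse_mx (lam : powers) (p : user) (x : 'cV[R[i]]_Nb) :
  (x^t* *m mmse_mx lam p *m x) 0 0 = (ul_den lam p x)%:C.
Proof.
rewrite /mmse_mx !(mulmxDr, mulmxDl) -?(scalemxAl, scalemxAr).
rewrite mxE [X in X + _]mxE [X in X + _ + _]mxE [X in _ + X]mxE.
rewrite (form_diag_part _ (Hmx_Lambda_diag lam p.1)) Hmx_noise.
rewrite mul_mx_scalar -scalemxAl [X in _ + X + _]mxE.
rewrite -[(x^t* *m x) 0 0]/(hdot x x) hdot_sqnorm mulmx_sumr mulmx_suml summxE.
rewrite (eq_bigr (fun q : user => (lam _[q] * sqmod (hdot x (h p.1)_[q]))%:C)).
  rewrite -realC_sum -!realC_M -!rmorphD /= /ul_den; congr (_%:C); ring.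
by move=> q _; rewrite -scalemxAr -scalemxAl mxE form_outer realC_M.
Qed.

Lemma SINR_ulE (lam : powers) (p : user) x :
  SINR_ul h alpha lam p.1 p.2 x
    = alpha ^+ 2 * lam _[p] * sqmod (hdot x (h p.1)_[p]) / ul_den lam p x.
Proof.
rewrite /SINR_ul; congr (_ / _); rewrite -surjective_pairing /Cq_ul qformZ.
rewrite (@qform_diag_part _ _ _ (fun k =>
  \sum_(q : user) lam _[q] * sqmod ((h p.1)_[q] k 0) + 1)); last first.
  by move=> k; rewrite mxE Hmx_Lambda_diag mxE eqxx rmorphD.
rewrite /ul_den -Hmx_noise sqnormE.
under [X in _ + _ * X + _]eq_bigr do rewrite mulrDl mul1r.
by rewrite big_split /=; ring.
Qed.

Lemma SINR_dlE (w : beams) (p : user) :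
  SINR_dl h alpha w p.1 p.2
    = alpha ^+ 2 * sqmod (hdot w _[p] (h p.1)_[p])
      / (alpha ^+ 2 * (\sum_(q : user | q != p)
                         sqmod (hdot w _[q] (h q.1)_[p]))
         + alpha * beta * (\sum_(q : user) noise w _[q] (h q.1)_[p]) + 1).
Proof.
rewrite /SINR_dl; congr (_ / _); rewrite -surjective_pairing.
congr (_ + _ + 1).
rewrite -(pair_bigA _ (fun j v => noise (w j v) (h j p.1 p.2))) mulr_sumr /=.
apply: eq_bigr => j _; rewrite /Cq_dl qformZ; congr (_ * _).
rewrite (@qform_diag_part _ _ _ (fun k => \sum_v sqmod (w j v k 0))).
  by under [LHS]eq_bigr do rewrite mulr_suml; rewrite exchange_big.
move=> k; rewrite mxE realC_sum; apply: eq_bigr => v _.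
by rewrite !mxE mulrC conjM_sqmod.
Qed.

Definition Sigma_entry (w : beams) (p q : user) : R :=
  if p == q then
    alpha ^+ 2 / gamma _[p] * sqmod (hdot w _[p] (h p.1)_[p])
    - alpha * beta * noise w _[p] (h p.1)_[p]
  else
    - (alpha ^+ 2 * sqmod (hdot w _[q] (h q.1)_[p]))
    - alpha * beta * noise w _[q] (h q.1)_[p].

(** Translates between functions on users and block columns, so that the algebra of [Sigma] can be
    done with plain sums. *)
Definition user_vec (v : user -> R) : 'cV[R]_(\sum_(i < Nc) Nu) :=
  \mxcol_i \col_u v (i, u).

Lemma Sigma_mul_user_vec (w : beams) v :
  Sigma h alpha gamma w *m user_vec v
    = user_vec (fun p => \sum_q Sigma_entry w p q * v q).
Proof.
rewrite /Sigma /user_vec mul_mxblock_mxrow; apply/eq_mxcol => i.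
apply/matrixP => u z; rewrite summxE [RHS]mxE.
have -> : \sum_q Sigma_entry w (i, u) q * v q
    = \sum_j \sum_u' Sigma_entry w (i, u) (j, u') * v (j, u').
  by rewrite pair_bigA; apply: eq_bigr => -[].
apply: eq_bigr => j _; rewrite mxE; apply: eq_bigr => u' _.
rewrite !mxE /Sigma_entry xpair_eqE /= !qform_diag_outer.
by case: ifP => // /andP[/eqP -> /eqP ->].
Qed.

Lemma user_vec0 : user_vec (fun=> 0) = 0.
Proof. by apply/matrixP => k l; rewrite !mxE. Qed.

Lemma user_vec_surj x : x = user_vec (fun p => submxcol x p.1 p.2 0).
Proof.
rewrite -[LHS]submxcolK; apply/eq_mxcol => i; apply/matrixP => u z.
by rewrite ord1 [RHS]mxE.
Qed.

Lemma submxcol_user_vec v p : submxcol (user_vec v) p.1 p.2 0 = v p.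
Proof. by rewrite mxcolK mxE -surjective_pairing. Qed.

(** Column [p] involves the single beam [w_p], so weighting it by [lam] collects what the uplink
    combiner [w_p] receives. The last term compensates the thermal noise, which is in [ul_den] but
    not in the matrix. *)
Lemma Sigma_colsum (lam : powers) (w : beams) (p : user) :
  \sum_q lam _[q] * Sigma_entry w q p
    = alpha ^+ 2 * lam _[p] * sqmod (hdot w _[p] (h p.1)_[p]) / gamma _[p]
      - ul_den lam p w _[p] + alpha * sqnorm w _[p].
Proof.
rewrite (bigD1 p) //= /Sigma_entry eqxx /ul_den.
rewrite [in RHS](bigD1 p (P := xpredT)) //=.
under eq_bigr => q qp do rewrite (negPf qp) mulrBr mulrN.
rewrite big_split /= !sumrN.
have -> : \sum_(q | q != p) lam _[q] * (alpha ^+ 2 * sqmod (hdot w _[p] (h p.1)_[q]))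
   = alpha ^+ 2 * \sum_(q | q != p) lam _[q] * sqmod (hdot w _[p] (h p.1)_[q]).
  by rewrite mulr_sumr; apply: eq_bigr => q _; ring.
have -> : \sum_(q | q != p) lam _[q] * (alpha * beta * noise w _[p] (h p.1)_[q])
   = alpha * beta * \sum_(q | q != p) lam _[q] * noise w _[p] (h p.1)_[q].
  by rewrite mulr_sumr; apply: eq_bigr => q _; ring.
by ring.
Qed.

(** Row [p] collects what reaches downlink user [p] from all beams, except the thermal noise [1]. *)
Lemma Sigma_rowsum (w : beams) (p : user) :
  \sum_q Sigma_entry w p q
    = alpha ^+ 2 * sqmod (hdot w _[p] (h p.1)_[p]) / gamma _[p]
      - (alpha ^+ 2 * (\sum_(q : user | q != p)
                         sqmod (hdot w _[q] (h q.1)_[p]))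
         + alpha * beta * (\sum_(q : user) noise w _[q] (h q.1)_[p])).
Proof.
rewrite (bigD1 p) //= /Sigma_entry eqxx.
rewrite [in RHS](bigD1 p (P := xpredT)) //=.
under eq_bigr => q qp do rewrite eq_sym (negPf qp).
by rewrite big_split /= !sumrN -!mulr_sumr; ring.
Qed.

Lemma Sigma_entry_scale (w w' : beams) (c : user -> R[i])
    (w'E : forall p, w' _[p] = c p *: w _[p]) p q :
  Sigma_entry w' p q = Sigma_entry w p q * sqmod (c q).
Proof.
rewrite /Sigma_entry !w'E !hdotZl !noiseZl !sqmodM !sqmodJ.
by case: eqP => [->|_]; ring.
Qed.

Hypothesis alpha_gt0 : 0 < alpha.
Hypothesis alpha_le1 : alpha <= 1.
Hypothesis gamma_gt0 : forall i u, 0 < gamma i u.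

Lemma quant_ge0 : 0 <= alpha * beta.
Proof. by rewrite mulr_ge0 ?subr_ge0 // ltW. Qed.

Lemma Sigma_entry_offdiag w p q : p != q -> Sigma_entry w p q <= 0.
Proof.
move=> /negPf pq; rewrite /Sigma_entry pq -opprD oppr_le0.
by rewrite addr_ge0 // mulr_ge0 ?quant_ge0 ?noise_ge0 ?sqmod_ge0 ?sqr_ge0.
Qed.

Lemma dl_feasibleE w :
  P2_feasible h alpha gamma w <-> forall p, 1 <= \sum_q Sigma_entry w p q.
Proof.
suff E p : (gamma _[p] <= SINR_dl h alpha w p.1 p.2)
    = (1 <= \sum_q Sigma_entry w p q).
  by split=> [H p|H i u]; [rewrite -E | rewrite (E (i, u))].
rewrite SINR_dlE Sigma_rowsum ler_pdivlMr; last first.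
  rewrite ltr_wpDl // addr_ge0 // mulr_ge0 ?quant_ge0 ?sqr_ge0 ?sumr_ge0 // => q _.
    exact: sqmod_ge0.
  exact: noise_ge0.
by rewrite mulrC -ler_pdivlMr // lerBrDr addrC.
Qed.

(** * MMSE beams and the maximal uplink SINR for fixed powers *)

Section Uplink.
Variable lam : powers.
Hypothesis lam_ge0 : forall i u, 0 <= lam i u.

Lemma ul_den_ge_sqnorm p x : alpha * sqnorm x <= ul_den lam p x.
Proof.
rewrite /ul_den lerDr addr_ge0 // mulr_ge0 ?quant_ge0 ?sqr_ge0 ?sumr_ge0 // => q _.
  by rewrite mulr_ge0 ?sqmod_ge0.
by rewrite mulr_ge0 ?noise_ge0.
Qed.

Lemma ul_den_ge0 p x : 0 <= ul_den lam p x.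
Proof.
by apply: le_trans (ul_den_ge_sqnorm p x); rewrite mulr_ge0 ?sqnorm_ge0 // ltW.
Qed.

Lemma ul_den_gt0 p x : x != 0 -> 0 < ul_den lam p x.
Proof.
move=> x0; apply: lt_le_trans (ul_den_ge_sqnorm p x).
by rewrite mulr_gt0 ?sqnorm_gt0.
Qed.

Lemma ul_den_eq0 p x : ul_den lam p x = 0 -> x = 0.
Proof. by move=> x0; apply: contra_eq x0 => /(ul_den_gt0 p)/gt_eqF ->. Qed.

Lemma mmse_mx_herm p : (mmse_mx lam p)^t* = mmse_mx lam p.
Proof.
have conjR (a : R) : (a%:C)^* = a%:C :> R[i] by exact: conjc_real.
(* Of the product [D], only the fact that its diagonal is real is kept. *)
rewrite /mmse_mx; move: (Hmx_Lambda_diag lam p.1).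
move: (_ *m (Hmx h p.1)^t*) => D DE.
apply/matrixP => k l; rewrite !mxE !rmorphD !rmorphM /= !conjR.
congr (_ + _ + _).
- congr (_ * _); rewrite !summxE rmorph_sum /=; apply: eq_bigr => q _.
  rewrite !mxE rmorphM /= conjR !big_ord1 !mxE rmorphM /= conjCK.
  by congr (_ * _); rewrite mulrC.
- by rewrite eq_sym; case: eqP; rewrite ?conjR ?rmorph0.
- congr (_ * _); rewrite eq_sym; case: eqP => [->|_]; last by rewrite rmorph0.
  by rewrite !mulr1n DE conjR.
Qed.

(** On a kernel vector the form [ul_den] vanishes, while it dominates [alpha] times the squared
    norm. *)
Lemma mmse_mx_unit p : mmse_mx lam p \in unitmx.
Proof.
rewrite -unitmx_tr -row_free_unit; apply: inj_row_free => v vK0.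
have Kv0 : mmse_mx lam p *m v^T = 0.
  by apply: trmx_inj; rewrite trmx_mul trmxK vK0 trmx0.
apply: trmx_inj; rewrite trmx0; apply: (@ul_den_eq0 p); apply: complexI.
by rewrite -form_mmse_mx -mulmxA Kv0 mulmx0 mxE.
Qed.

Local Notation f := (mmse h alpha lam).

Lemma mmse_mxK p : mmse_mx lam p *m f _[p] = (h p.1)_[p].
Proof. by rewrite mmseE mulKVmx ?mmse_mx_unit. Qed.

Lemma mmse_neq0 p : (h p.1)_[p] != 0 -> f _[p] != 0.
Proof. by apply: contraNneq => f0; rewrite -mmse_mxK f0 mulmx0. Qed.

Lemma hdot_mmse p : hdot f _[p] (h p.1)_[p] = (ul_den lam p f _[p])%:C.
Proof. by rewrite -form_mmse_mx -mulmxA mmse_mxK. Qed.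

Lemma ul_den_sub_proj p x e (c := (hdot x (h p.1)_[p])^* / (ul_den lam p e)%:C) :
    mmse_mx lam p *m e = (h p.1)_[p] -> e != 0 ->
  sqmod (hdot x (h p.1)_[p])
    = (ul_den lam p x - ul_den lam p (x - c *: e)) * ul_den lam p e.
Proof.
move=> Ke /(ul_den_gt0 p) e0.
have xe : (x^t* *m mmse_mx lam p *m e) 0 0 = hdot x (h p.1)_[p].
  by rewrite -mulmxA Ke.
have e0C : (ul_den lam p e)%:C != 0.
  by rewrite -[0]/(0%:C) (inj_eq (@complexI R)) gt_eqF.
have := form_sub_proj (mmse_mx_herm p) (form_mmse_mx lam p x)
  (form_mmse_mx lam p e) xe e0C.
rewrite -/c (form_mmse_mx lam p (x - c *: e)) -sqmodE -!realC_M => subE.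
apply: complexI; rewrite mulrBl rmorphB /= subE opprB addrCA subrr.
by rewrite addr0.
Qed.

(** Coefficient of the projection of [x] onto the line of [f_p], orthogonal for the form of
    [mmse_mx]. *)
Definition mmse_coef p (x : 'cV[R[i]]_Nb) : R[i] :=
  (hdot x (h p.1)_[p])^* / (ul_den lam p f _[p])%:C.

Lemma ul_den_sub_mmse p x : f _[p] != 0 ->
  sqmod (hdot x (h p.1)_[p])
    = (ul_den lam p x - ul_den lam p (x - mmse_coef p x *: f _[p]))
      * ul_den lam p f _[p].
Proof. exact: ul_den_sub_proj (mmse_mxK p). Qed.

Lemma ul_cauchy_schwarz p x : f _[p] != 0 ->
  sqmod (hdot x (h p.1)_[p]) <= ul_den lam p x * ul_den lam p f _[p].
Proof.
move=> f0; rewrite ul_den_sub_mmse // ler_wpM2r ?ul_den_ge0 //.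
by rewrite gerBl ul_den_ge0.
Qed.

Lemma SINR_ul_mmse p : f _[p] != 0 ->
  SINR_ul h alpha lam p.1 p.2 f _[p] = alpha ^+ 2 * lam _[p] * ul_den lam p f _[p].
Proof.
move=> f0; have D0 := ul_den_gt0 p f0; rewrite SINR_ulE hdot_mmse.
by rewrite sqmod_real expr2 mulrA mulfK // gt_eqF.
Qed.

Lemma mmse_is_max p : f _[p] != 0 ->
  is_max_SINR_ul h alpha lam p.1 p.2 (SINR_ul h alpha lam p.1 p.2 f _[p]).
Proof.
move=> f0; split; first by exists (f _[p]).
move=> x x0; rewrite SINR_ul_mmse // SINR_ulE ler_pdivrMr ?ul_den_gt0 //.
rewrite -[leRHS]mulrA ler_wpM2l //; last by rewrite mulrC ul_cauchy_schwarz.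
by rewrite mulr_ge0 ?sqr_ge0.
Qed.

(** Reads the uplink constraint at [p] as the sign of the excess of the column sum over
    [alpha * sqnorm]. *)
Lemma Sigma_colsum_SINR w p : w _[p] != 0 ->
  \sum_q lam _[q] * Sigma_entry w q p = alpha * sqnorm w _[p]
    + ul_den lam p w _[p] / gamma _[p]
      * (SINR_ul h alpha lam p.1 p.2 w _[p] - gamma _[p]).
Proof.
move=> w0; rewrite Sigma_colsum SINR_ulE.
have D0 : ul_den lam p w _[p] != 0 by rewrite gt_eqF ?ul_den_gt0.
have g0 : gamma _[p] != 0 by rewrite gt_eqF.
move: (ul_den _ _ _) (gamma _ _) D0 g0 => D g D0 g0.
by field; rewrite D0.
Qed.

(** Tightness says [gamma_p = alpha^2 lam_p ul_den(f_p)], so by [ul_den_sub_mmse] the signal term of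
    [Sigma_colsum] is [ul_den] of [w_p] minus that of the residual. *)
Lemma Sigma_colsum_tight w p : f _[p] != 0 ->
    SINR_ul h alpha lam p.1 p.2 f _[p] = gamma _[p] ->
  \sum_q lam _[q] * Sigma_entry w q p = alpha * sqnorm w _[p]
    - ul_den lam p (w _[p] - mmse_coef p w _[p] *: f _[p]).
Proof.
move=> f0; rewrite SINR_ul_mmse // => gE.
have g0 : gamma _[p] != 0 by rewrite gt_eqF.
rewrite Sigma_colsum ul_den_sub_mmse //.
move: (ul_den _ _ (_ - _)) (ul_den _ _ w _[p]) (ul_den _ _ _) gE => E D F gE.
by rewrite [_ * F]mulrC mulrA gE mulrAC mulfV // mul1r; ring.
Qed.

End Uplink.

(** A zero power or a zero channel would make the SINR zero, below the positive target. *)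
Lemma P1_feasible_gt0 (g : beams) (lam : powers) p : P1_feasible h alpha gamma g lam ->
  0 < lam _[p] /\ (h p.1)_[p] != 0.
Proof.
case=> _ lam_ge0 /(_ p.1 p.2)[m [[x x0 xm] _] /(lt_le_trans (gamma_gt0 _ _))].
rewrite -xm SINR_ulE ltNge => num; split.
  rewrite lt_neqAle lam_ge0 andbT; apply: contraNneq num => <-.
  by rewrite mulr0 !mul0r.
apply: contraNneq num => ->; rewrite hdot0r.
by rewrite (eqP (_ : sqmod 0 == 0)) ?sqmod_eq0 // mulr0 mul0r.
Qed.

(** * Tight constraints at the uplink optimum and the downlink solutions *)

Section UplinkOptimum.
Variables (g : beams) (lam : powers).
Hypothesis lam_opt : P1_optimal h alpha gamma g lam.
Local Notation f := (mmse h alpha lam).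

Lemma opt_gt0 p : 0 < lam _[p].
Proof. by case: (P1_feasible_gt0 p lam_opt.1). Qed.

Lemma opt_ge0 i u : 0 <= lam i u.
Proof. exact/ltW/(opt_gt0 (i, u)). Qed.

Lemma opt_mmse_neq0 p : f _[p] != 0.
Proof.
by apply: mmse_neq0 opt_ge0 _ _; case: (P1_feasible_gt0 p lam_opt.1).
Qed.

Lemma P1_objectiveE (l : powers) : P1_objective l = \sum_p l _[p].
Proof. by rewrite /P1_objective pair_bigA. Qed.

Lemma P2_objectiveE (w : beams) :
  P2_objective alpha w = \sum_p alpha * sqnorm w _[p].
Proof. by rewrite /P2_objective pair_bigA mulr_sumr. Qed.

Lemma opt_SINR_ge p : gamma _[p] <= SINR_ul h alpha lam p.1 p.2 f _[p].
Proof.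
case: lam_opt.1 => _ _ /(_ p.1 p.2)[m [[x x0 <-] _] gm].
apply: le_trans gm _.
by case: (mmse_is_max opt_ge0 (opt_mmse_neq0 p)) => _; exact.
Qed.

(* Otherwise [lam p] can be lowered until the constraint at [p], for the fixed
   combiner [f p], is tight; the other constraints only get looser. *)
Lemma opt_SINR p : SINR_ul h alpha lam p.1 p.2 f _[p] = gamma _[p].
Proof.
apply/eqP; rewrite eq_le opt_SINR_ge andbT leNgt; apply/negP => slack.
have den_gt0 r : 0 < ul_den lam r f _[r] / gamma _[r].
  by rewrite divr_gt0 // ul_den_gt0 ?opt_mmse_neq0 //; exact: opt_ge0.
have f_gt0 r : 0 < alpha * sqnorm f _[r].
  by rewrite mulr_gt0 ?sqnorm_gt0 ?opt_mmse_neq0.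
have colE r := Sigma_colsum_SINR opt_ge0 (opt_mmse_neq0 r).
pose s := ul_den lam p f _[p] / gamma _[p]
  * (SINR_ul h alpha lam p.1 p.2 f _[p] - gamma _[p]).
have s_gt0 : 0 < s by rewrite mulr_gt0 ?subr_gt0.
have off_le0 : \sum_(q | q != p) lam _[q] * Sigma_entry f q p <= 0.
  apply: sumr_le0 => q qp; apply: mulr_ge0_le0; first exact: opt_ge0.
  exact: Sigma_entry_offdiag.
have diagE : lam _[p] * Sigma_entry f p p
    = alpha * sqnorm f _[p] + s - \sum_(q | q != p) lam _[q] * Sigma_entry f q p.
  by rewrite -(colE p) (bigD1 p) //= addrK.
have App_gt0 : 0 < Sigma_entry f p p.
  rewrite -(pmulr_rgt0 _ (opt_gt0 p)) diagE; have := f_gt0 p; lra.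
(* Lowering [lam p] by [d] lowers the sum of column [p] by exactly its excess [s]. *)
pose d := s / Sigma_entry f p p.
have d_gt0 : 0 < d by rewrite divr_gt0.
have dA : d * Sigma_entry f p p = s by rewrite divfK // gt_eqF.
pose lam' i u := lam i u - (if (i, u) == p then d else 0).
have lam'E q : lam' q.1 q.2 = lam _[q] - (if q == p then d else 0).
  by rewrite /lam' -surjective_pairing.
(* At [p], the new power times the diagonal entry is [alpha * sqnorm] minus the nonpositive
   off-diagonal sum. *)
have lam'_ge0 i u : 0 <= lam' i u.
  rewrite (lam'E (i, u)); case: eqP => [-> |_]; last by rewrite subr0 opt_ge0.
  rewrite -(pmulr_lge0 _ App_gt0) mulrBl dA diagE; have := f_gt0 p; lra.
have sumE (F : user -> R) : \sum_q lam' q.1 q.2 * F q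
    = \sum_q lam _[q] * F q - d * F p.
  under eq_bigr do rewrite lam'E mulrBl.
  rewrite sumrB; congr (_ - _); rewrite (bigD1 p) //= eqxx big1 ?addr0 //.
  by move=> q /negPf ->; rewrite mul0r.
(* The excess of column [r] becomes zero for [r = p]; otherwise it changes by [- d] times a
   nonpositive off-diagonal entry, hence does not decrease. *)
have SINR'_ge r : gamma _[r] <= SINR_ul h alpha lam' r.1 r.2 f _[r].
  have den'_gt0 : 0 < ul_den lam' r f _[r] / gamma _[r].
    by rewrite divr_gt0 // ul_den_gt0 ?opt_mmse_neq0.
  rewrite -subr_ge0 -(pmulr_rge0 _ den'_gt0).
  have := Sigma_colsum_SINR lam'_ge0 (opt_mmse_neq0 r).
  rewrite (sumE (fun q => Sigma_entry f q r)) (colE r) -addrA => /addrI <-.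
  have [<-|pr] := eqVneq p r; first by rewrite dA subrr.
  rewrite subr_ge0; apply: (@le_trans _ _ 0).
    by apply: mulr_ge0_le0; [exact: ltW | exact: Sigma_entry_offdiag].
  by apply: mulr_ge0; [exact: ltW | rewrite subr_ge0 opt_SINR_ge].
(* Feasibility asks for an attained maximum: the MMSE beam of [lam'] provides it and does at least
   as well as the old [f]. *)
have lam'_feas : P1_feasible h alpha gamma f lam'.
  split=> [i u|//|i u]; first exact: opt_mmse_neq0 (i, u).
  have [_ h0] := P1_feasible_gt0 (i, u) lam_opt.1.
  have max' := mmse_is_max lam'_ge0 (mmse_neq0 lam'_ge0 h0).
  exists (SINR_ul h alpha lam' i u (mmse h alpha lam' i u)); first exact: max'.
  apply: le_trans (SINR'_ge (i, u)) _.
  by apply: max'.2; exact: opt_mmse_neq0 (i, u).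
have := lam_opt.2 _ _ lam'_feas; apply/negP; rewrite -ltNge !P1_objectiveE.
have := sumE (fun=> 1); rewrite -!mulr_suml !mulr1 => ->.
by rewrite gtrBl.
Qed.

Lemma opt_colsum w p : \sum_q lam _[q] * Sigma_entry w q p
  = alpha * sqnorm w _[p]
    - ul_den lam p (w _[p] - mmse_coef lam p w _[p] *: f _[p]).
Proof. exact: Sigma_colsum_tight opt_ge0 _ _ (opt_mmse_neq0 p) (opt_SINR p). Qed.

Lemma opt_colsum_mmse p :
  \sum_q lam _[q] * Sigma_entry f q p = alpha * sqnorm f _[p].
Proof.
by rewrite (Sigma_colsum_SINR opt_ge0 (opt_mmse_neq0 p)) opt_SINR subrr mulr0 addr0.
Qed.

Lemma Sigma_monotone v : (forall p, 0 <= \sum_q Sigma_entry f p q * v q) ->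
  forall p, 0 <= v p.
Proof.
apply: (@Zmatrix_monotone _ _ _ (fun p => lam _[p])) => [p q|p|p].
- exact: Sigma_entry_offdiag.
- exact: opt_ge0.
- by rewrite opt_colsum_mmse mulr_gt0 ?sqnorm_gt0 ?opt_mmse_neq0.
Qed.

(** [Sigma_monotone] applies to both differences [v - v'] and [v' - v], whose images vanish. *)
Lemma Sigma_inj v v' :
    (forall p, \sum_q Sigma_entry f p q * v q = \sum_q Sigma_entry f p q * v' q) ->
  forall p, v p = v' p.
Proof.
move=> vv' p; apply/eqP; rewrite eq_le -[v p <= _]subr_ge0 -[v' p <= _]subr_ge0.
by apply/andP; split; apply: (Sigma_monotone (v := fun p => _ p - _ p)) => {}p;
  under eq_bigr do rewrite mulrBr; rewrite sumrB vv' subrr.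
Qed.

Lemma Sigma_unit : Sigma h alpha gamma f \in unitmx.
Proof.
rewrite -unitmx_tr -row_free_unit; apply: inj_row_free => v vS0.
have : Sigma h alpha gamma f *m v^T = 0.
  by apply: trmx_inj; rewrite trmx_mul trmxK vS0 trmx0.
rewrite [v^T]user_vec_surj Sigma_mul_user_vec => Sv0.
apply: trmx_inj; rewrite [v^T]user_vec_surj trmx0.
have v0 p : submxcol v^T p.1 p.2 0 = 0.
  move: p; apply: (Sigma_inj (v' := fun=> 0)) => p.
  rewrite -[LHS](submxcol_user_vec
    (fun p => \sum_q Sigma_entry f p q * submxcol v^T q.1 q.2 0)) Sv0 !mxE.
  by rewrite big1 // => q _; rewrite mulr0.
rewrite -user_vec0; apply/eq_mxcol => i; apply/matrixP => u z.
by rewrite [LHS]mxE [RHS]mxE; exact: v0 (i, u).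
Qed.

Local Notation t := (tau h alpha gamma f).

Lemma Sigma_tau p : \sum_q Sigma_entry f p q * t _[q] = 1.
Proof.
have : Sigma h alpha gamma f *m tau_vec h alpha gamma f = const_mx 1.
  by rewrite /tau_vec mulKVmx ?Sigma_unit.
rewrite [tau_vec _ _ _ _]user_vec_surj Sigma_mul_user_vec => St.
by rewrite -[LHS](submxcol_user_vec
  (fun p => \sum_q Sigma_entry f p q * t _[q])) St !mxE.
Qed.

Lemma tau_ge0 p : 0 <= t _[p].
Proof. by apply: (Sigma_monotone (v := fun p => t _[p])) => q; rewrite Sigma_tau. Qed.

(** The duality gap, from summing [opt_colsum] over [p] and exchanging sums: the first extra sum is
    the downlink slack priced by [lam], the second measures how far each [w_p] is from the line of
    [f_p]. *)
Lemma dl_gap w : P2_objective alpha w = P1_objective lam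
  + \sum_p lam _[p] * (\sum_q Sigma_entry w p q - 1)
  + \sum_p ul_den lam p (w _[p] - mmse_coef lam p w _[p] *: f _[p]).
Proof.
rewrite P2_objectiveE P1_objectiveE.
have -> : \sum_p lam _[p] * (\sum_q Sigma_entry w p q - 1)
    = \sum_p \sum_q lam _[q] * Sigma_entry w q p - \sum_p lam _[p].
  rewrite exchange_big -sumrB; apply: eq_bigr => p _.
  by rewrite mulrBr mulr1 mulr_sumr.
rewrite addrC subrKC -big_split /=; apply: eq_bigr => p _.
by rewrite opt_colsum; ring.
Qed.

(** Scaling the beams multiplies column [q] by [t_q], so every row sum becomes [1]. Pairing
    [Sigma t = 1] with [lam] gives the objective. *)
Lemma scaled_mmse_opt w c
    (ct : forall p, sqmod (c p) = t _[p]) (wE : forall p, w _[p] = c p *: f _[p]) :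
  P2_feasible h alpha gamma w /\ P2_objective alpha w = P1_objective lam.
Proof.
split.
  apply/dl_feasibleE => p; rewrite -(Sigma_tau p) le_eqVlt; apply/orP; left.
  by apply/eqP/eq_bigr => q _; rewrite (Sigma_entry_scale wE) ct.
rewrite P2_objectiveE P1_objectiveE.
transitivity (\sum_p \sum_q lam _[q] * Sigma_entry f q p * t _[p]).
  apply: eq_bigr => p _; rewrite -mulr_suml opt_colsum_mmse.
  by rewrite wE sqnormZ ct; ring.
rewrite exchange_big; apply: eq_bigr => p _ /=.
by under eq_bigr do rewrite -mulrA; rewrite -mulr_sumr Sigma_tau mulr1.
Qed.

Lemma dl_optimalP w : P2_optimal h alpha gamma w <->
  exists c, (forall p, sqmod (c p) = t _[p]) /\ (forall p, w _[p] = c p *: f _[p]).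
Proof.
have row_ge0 v p : P2_feasible h alpha gamma v ->
    0 <= lam _[p] * (\sum_q Sigma_entry v p q - 1).
  move=> /dl_feasibleE v_feas.
  by rewrite mulr_ge0 ?subr_ge0 //; exact: opt_ge0.
have den_ge0 v p : 0 <= ul_den lam p (v _[p] - mmse_coef lam p v _[p] *: f _[p]).
  exact: ul_den_ge0 opt_ge0 _ _.
split=> [[w_feas w_opt]|[c [ct wc]]]; last first.
  have [w_feas w_obj] := scaled_mmse_opt ct wc; split=> // v v_feas.
  by rewrite w_obj dl_gap -addrA lerDl addr_ge0 ?sumr_ge0 // => p _; exact: row_ge0.
(* The beams with real scalings reach the uplink value, so an optimal [w] has no gap and both
   nonnegative sums in [dl_gap] vanish termwise. *)
pose c0 p := (Num.sqrt t _[p])%:C.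
pose w0 i u := c0 (i, u) *: f i u.
have c0t p : sqmod (c0 p) = t _[p] by rewrite sqmod_real sqr_sqrtr ?tau_ge0.
have w0E p : w0 p.1 p.2 = c0 p *: f _[p] by rewrite /w0 -surjective_pairing.
have [w0_feas w0_obj] := scaled_mmse_opt c0t w0E.
have := w_opt _ w0_feas; rewrite w0_obj dl_gap -addrA gerDl.
have sum_row_ge0 : 0 <= \sum_p lam _[p] * (\sum_q Sigma_entry w p q - 1).
  by apply: sumr_ge0 => p _; exact: row_ge0.
have sum_den_ge0 :
    0 <= \sum_p ul_den lam p (w _[p] - mmse_coef lam p w _[p] *: f _[p]).
  by apply: sumr_ge0 => p _; exact: den_ge0.
move=> gap_le0; have /eqP := le_anti (introT andP (conj gap_le0
  (addr_ge0 sum_row_ge0 sum_den_ge0))).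
rewrite paddr_eq0 // !psumr_eq0 // => [/andP[/allP row0 /allP den0]|p _]; last first.
  exact: row_ge0.
have wE p : w _[p] = mmse_coef lam p w _[p] *: f _[p].
  apply: subr0_eq; apply: (ul_den_eq0 opt_ge0 (p := p)); apply/eqP.
  exact: den0 (mem_index_enum p).
exists (fun p => mmse_coef lam p w _[p]); split=> //.
(* As [lam p > 0], zero priced slack means that row [p] of the matrix for [w] sums to [1]; hence the
   squared moduli of the coefficients solve the system defining [tau]. *)
apply: Sigma_inj => p; rewrite Sigma_tau.
under eq_bigr do rewrite -(Sigma_entry_scale wE).
apply/eqP; rewrite -subr_eq0; have := row0 p (mem_index_enum p).
by rewrite mulf_eq0 gt_eqF ?opt_gt0.
Qed.

End UplinkOptimum.
End System.

(** * Splitting the coefficients into phase and modulus *)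

Theorem corollary3 (R : realType) (Nc Nu Nb : nat)
    (Nc_gt0 : (0 < Nc)%N) (Nu_gt0 : (0 < Nu)%N) (Nb_gt0 : (0 < Nb)%N)
    (h : 'I_Nc -> 'I_Nc -> 'I_Nu -> 'cV[R[i]]_Nb)
    (alpha : R) (alpha_gt0 : 0 < alpha) (alpha_le1 : alpha <= 1)
    (gamma : 'I_Nc -> 'I_Nu -> R) (gamma_gt0 : forall i u, 0 < gamma i u)
    (P1_is_feasible : exists g lam, P1_feasible h alpha gamma g lam)
    (P2_is_feasible : exists w, P2_feasible h alpha gamma w)
    (g : 'I_Nc -> 'I_Nu -> 'cV[R[i]]_Nb) (lam : 'I_Nc -> 'I_Nu -> R)
    (lam_optimal : P1_optimal h alpha gamma g lam) :
  let f := mmse h alpha lam in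
  let t := tau h alpha gamma f in
  [/\ Sigma h alpha gamma f \in unitmx,
      forall i u, 0 <= t i u
    & forall w : 'I_Nc -> 'I_Nu -> 'cV[R[i]]_Nb,
        P2_optimal h alpha gamma w <->
        exists c : 'I_Nc -> 'I_Nu -> R[i],
          (forall i u, `|c i u| = 1) /\
          (forall i u, w i u = (c i u * (Num.sqrt (t i u))%:C) *: f i u)].
Proof.
move=> f t.
have t_ge0 i u : 0 <= t i u.
  exact: (tau_ge0 alpha_gt0 alpha_le1 gamma_gt0 lam_optimal (i, u)).
split=> // [|w]; first exact: Sigma_unit lam_optimal.
rewrite (dl_optimalP alpha_gt0 alpha_le1 gamma_gt0 lam_optimal).
split=> [[c [ct wE]]|[c [c1 wE]]].
  have cE i u : `|c (i, u)| = (Num.sqrt (t i u))%:C.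
    by rewrite -[t i u](ct (i, u)) sqrt_sqmod.
  (* Where [t i u = 0] the coefficient is zero and any phase would do; [1] is taken. *)
  exists (fun i u => if t i u == 0 then 1 else c (i, u) / (Num.sqrt (t i u))%:C).
  split=> i u; rewrite ?[w i u](wE (i, u)); case: eqVneq => [t0|t_neq0].
  - exact: normr1.
  - have t_gt0 : 0 < (Num.sqrt (t i u))%:C by rewrite ltcR sqrtr_gt0 lt0r t_neq0 t_ge0.
    by rewrite normf_div cE gtr0_norm // divff // gt_eqF.
  - have -> : c (i, u) = 0 by apply/eqP; rewrite -normr_eq0 cE t0 sqrtr0.
    by rewrite t0 sqrtr0 mulr0.
  - have t_gt0 : 0 < (Num.sqrt (t i u))%:C by rewrite ltcR sqrtr_gt0 lt0r t_neq0 t_ge0.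
    by rewrite divfK // gt_eqF.
exists (fun p => c p.1 p.2 * (Num.sqrt (t p.1 p.2))%:C); split=> p; last exact: wE.
rewrite sqmodM sqmod_real sqr_sqrtr //.
have -> : sqmod (c p.1 p.2) = 1 by apply: complexI; rewrite sqmodE c1 expr1n.
by rewrite mul1r.
Qed.
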